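(* Let $n$ be a positive integer. (a) $\mu(n,3)=\mu(n,2)$. (b) If $n\ge 3$, then $\mu^*(n,3)=4k-1$ if $n=6k-3$ for some positive integer $k$, and $\mu^*(n,3)=\mu(n,3)$ otherwise.
   Context: Let $\mathbb F_2=\{0,1\}$ be the field with two elements. For $u\in\mathbb F_2^n$, $|u|$ denotes the Hamming weight of $u$ (the number of entries equal to $1$). A wiring on $n$ vertices is a matrix $W=(w_{i,j})\in M(n,n;\mathbb F_2)$ with $w_{i,i}=1$ for all $i$. The degree of vertex $j$ is the number of $1$s in the $j$th column of $W$, and $\deg(W)$ is the maximum degree over all vertices. For $c\in\mathbb F_2^n$, $M(W,c)=\max\{|Wx+c| : x\in\mathbb F_2^n\}$. For $n,m\ge1$, $A(n,m)$ is the set of wirings on $n$ vertices with $\deg(W)\le m$; for $n\ge m$, $A^*(n,m)$ is the set of wirings on $n$ vertices in which every vertex has degree exactly $m$. Define $\mu(n,m)=\min\{M(W,0): W\in A(n,m)\}$ and, for $n\ge m$, $\mu^*(n,m)=\min\{M(W,0): W\in A^*(n,m)\}$. *)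

(* Defs.v *)
From mathcomp Require Import all_boot all_order all_algebra.
Set Implicit Arguments. Unset Strict Implicit. Unset Printing Implicit Defensive.
Import GRing.Theory.
Local Open Scope ring_scope.

Definition hweight n (u : 'cV['F_2]_n) : nat := #|[set i | u i 0 != 0]|.

Definition is_wiring n (W : 'M['F_2]_n) : bool := [forall i, W i i == 1].

Definition vdeg n (W : 'M['F_2]_n) (j : 'I_n) : nat := #|[set i | W i j != 0]|.

Definition wdeg n (W : 'M['F_2]_n) : nat := \max_(j : 'I_n) vdeg W j.

Definition Mval n (W : 'M['F_2]_n) (c : 'cV['F_2]_n) : nat :=
  \max_(x : 'cV['F_2]_n) hweight (W *m x + c).

Definition inA n m (W : 'M['F_2]_n) : bool := is_wiring W && (wdeg W <= m)%N.
Definition inAstar n m (W : 'M['F_2]_n) : bool :=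
  is_wiring W && [forall j, vdeg W j == m].

(* minima; the default n is an upper bound for every M(W,0), and the sets
   are nonempty whenever used (identity in A(n,m) for m>=1) *)
Definition mu n m : nat := \big[minn/n]_(W : 'M['F_2]_n | inA m W) Mval W 0.
Definition mustar n m : nat :=
  \big[minn/n]_(W : 'M['F_2]_n | inAstar m W) Mval W 0.

(* Main.v *)
From HB Require Import structures.
Require Import Defs.
From mathcomp Require Import all_boot all_order all_algebra.
From mathcomp Require Import zify.

(* The columns of a wiring are sets, added by symmetric difference; M(W,0) is
   the largest size of a set in their span.  Take a maximal family F of disjoint
   columns of size 3 and let R be its complement, on which every column leaves
   at most two points.  Adding columns of F, any word can be made to meet each
   member of F in two points without changing it on R, so only R matters for the
   bound 2n/3.  There, a trace of size one and an isolated pair beat the ratio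
   2/3, and otherwise R splits into blocks of three points carrying two
   overlapping pairs, on which two points can be reached.

   If all columns have size 3 and the bound is attained, then picking one of the
   three nonzero words h, h', h + h' in each block always gives a sum that is
   not constant on any member of F, for otherwise that member could be filled
   completely.  Hence each member of F meets the words of exactly one block,
   while each h has exactly one point outside R; this matches the blocks with
   F, so that n = 6 |F|. *)

Set Implicit Arguments.
Unset Strict Implicit.
Unset Printing Implicit Defensive.

(** * Symmetric difference and the span of a family of sets *)

Section Span.
Variable T : finType.
Implicit Types (x y g h A P R S : {set T}) (G : {set {set T}}).

Definition symd (A B : {set T}) : {set T} := [set i | (i \in A) (+) (i \in B)].

Lemma in_symd (A B : {set T}) i : (i \in symd A B) = (i \in A) (+) (i \in B).
Proof. by rewrite inE. Qed.

Lemma symdA : associative symd.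
Proof. by move=> A B C; apply/setP=> i; rewrite !in_symd addbA. Qed.

Lemma symdC : commutative symd.
Proof. by move=> A B; apply/setP=> i; rewrite !in_symd addbC. Qed.

Lemma sym0d : left_id set0 symd.
Proof. by move=> A; apply/setP=> i; rewrite in_symd inE. Qed.

HB.instance Definition _ := Monoid.isComLaw.Build {set T} set0 symd symdA symdC sym0d.

Lemma in_bigsymd (I : finType) (D : {set I}) (F : I -> {set T}) i :
  (i \in \big[symd/set0]_(j in D) F j) = \big[addb/false]_(j in D) (i \in F j).
Proof.
by apply: (big_morph (fun A => i \in A)) => [A B|]; rewrite ?in_symd ?inE.
Qed.

Inductive span G : {set T} -> Prop :=
| span0 : span G set0
| span_add g x of g \in G & span G x : span G (symd g x).

Lemma span_symd G x y : span G x -> span G y -> span G (symd x y).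
Proof.
move=> sx sy; elim: sx => [|g z gG _ IH]; first by rewrite sym0d.
by rewrite -symdA; apply: span_add.
Qed.

Lemma span_gen G g : g \in G -> span G g.
Proof.
move=> gG; have := span_add gG (span0 G).
by rewrite symdC sym0d.
Qed.

Lemma span_big G (I : finType) (D : {set I}) (F : I -> {set T}) :
  (forall j, j \in D -> span G (F j)) -> span G (\big[symd/set0]_(j in D) F j).
Proof. by move=> h; apply: big_ind => //; [apply: span0|apply: span_symd]. Qed.

Lemma span_sub G G' x : G \subset G' -> span G x -> span G' x.
Proof.
move=> /subsetP sG; elim=> [|g y gG _ IH]; first exact: span0.
by apply: span_add => //; apply: sG.
Qed.

Lemma span_avoid G A x :
  (forall g, g \in G -> [disjoint g & A]) -> span G x -> [disjoint x & A].
Proof.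
move=> dG; elim=> [|g y gG _ IH]; first by rewrite disjoints_subset sub0set.
apply/pred0P=> i /=; rewrite in_symd; case iA: (i \in A); last by rewrite andbF.
by rewrite (disjointFl (dG g gG) iA) (disjointFl IH iA).
Qed.

Lemma card_symd_complement x g A : A \subset g -> #|symd g x :&: A| = #|A :\: x|.
Proof.
move/subsetP=> sA; apply: eq_card => i; rewrite !inE.
by case iA: (i \in A); rewrite ?andbF // (sA _ iA) !andbT.
Qed.

Lemma card_symd_away x g A : [disjoint g & A] -> #|symd g x :&: A| = #|x :&: A|.
Proof.
move=> dA; apply: eq_card => i; rewrite !inE.
by case iA: (i \in A); rewrite ?andbF // (disjointFl dA iA).
Qed.

Lemma card_traceD x A P : P \subset A -> #|x :&: A| = #|x :&: P| + #|x :&: (A :\: P)|.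
Proof.
move=> /setIidPr PA; rewrite -(cardsID P (x :&: A)); congr addn; apply: eq_card => i.
  by rewrite -setIA PA.
by rewrite !inE; case: (i \in x); rewrite /= ?andbF.
Qed.

Lemma cards3P g : #|g| = 3 -> exists a b c,
  [/\ a != b, a != c, b != c & g = [set a; b; c]].
Proof.
move=> g3; have : 0 < #|g| by rewrite g3.
case/card_gt0P=> a ag.
have /cards2P [b [c [bc gE]]] : #|g :\ a| == 2 by move: g3; rewrite (cardsD1 a) ag; lia.
have gE' i : (i \in g :\ a) = (i == b) || (i == c) by rewrite gE !inE.
exists a, b, c; split => //.
- by apply/eqP=> ab; move: (gE' b); rewrite -ab !inE !eqxx.
- by apply/eqP=> ab; move: (gE' c); rewrite -ab !inE !eqxx orbT.
by rewrite -[g](setD1K ag) gE setUA.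
Qed.

Lemma card_trace3 x a b c : a != b -> a != c -> b != c ->
  #|x :&: [set a; b; c]| = (a \in x) + (b \in x) + (c \in x).
Proof.
move=> ab ac bc; rewrite -sum1_card.
under eq_bigl => i do rewrite inE.
rewrite big_mkcondl /= -setUA big_setU1 ?inE ?negb_or ?ab //= big_setU1 ?inE //= big_set1.
by case: (a \in x); case: (b \in x); case: (c \in x).
Qed.

Lemma overlapping_pairsP (A B : {set T}) : #|A| = 2 -> #|B| = 2 -> #|A :|: B| = 3 ->
  exists a b c, [/\ a != b, a != c, b != c & A = [set a; b] /\ B = [set b; c]].
Proof.
move=> A2 B2 U3.
have I1 : #|A :&: B| == 1 by have := cardsUI A B; lia.
case/cards1P: I1 => b Ib.
have /setIP [bA bB] : b \in A :&: B by rewrite Ib set11.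
have A1 : #|A :\ b| == 1 by move: A2; rewrite (cardsD1 b) bA; lia.
have B1 : #|B :\ b| == 1 by move: B2; rewrite (cardsD1 b) bB; lia.
case/cards1P: A1 => a Aa; case/cards1P: B1 => c Bc.
have /setD1P [ab aA] : a \in A :\ b by rewrite Aa set11.
have /setD1P [cb cB] : c \in B :\ b by rewrite Bc set11.
exists a, b, c; split => //; last 2 first.
- by rewrite eq_sym.
- by rewrite -(setD1K bA) Aa -(setD1K bB) Bc setUC.
apply/eqP=> ac; have : a \in A :&: B by rewrite inE aA ac cB.
by rewrite Ib inE (negbTE ab).
Qed.

(** The pairs {a, b} and {b, c} generate all even words on {a, b, c}, and each of the two cosets of
    even words contains a word of size at least two. So adding [g], [h], both or neither to [x]
    succeeds; neither of them touches the rest of [S]. *)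
Lemma gain_pairs G g h S x : g \in G -> h \in G -> #|g :&: S| = 2 -> #|h :&: S| = 2 ->
  #|(g :|: h) :&: S| = 3 -> span G x ->
  exists x', [/\ span G x', 2 <= #|x' :&: ((g :|: h) :&: S)| &
    #|x' :&: (S :\: ((g :|: h) :&: S))| = #|x :&: (S :\: ((g :|: h) :&: S))|].
Proof.
move=> gG hG g2 h2; rewrite setIUl => U3 sx.
have [a [b [c [ab ac bc [gE hE]]]]] := overlapping_pairsP g2 h2 U3.
set P := _ :|: _ in U3 *.
have PE : P = [set a; b; c].
  by rewrite /P gE hE; apply/setP=> i; rewrite !inE; case: (i == a); case: (i == b).
have inS i : i \in [set a; b; c] -> i \in S.
  by rewrite -PE /P -setIUl inE => /andP[].
have [aS bS cS] : [/\ a \in S, b \in S & c \in S].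
  by split; apply: inS; rewrite !inE eqxx ?orbT.
have gin i : i \in S -> (i \in g) = (i == a) || (i == b).
  by move=> iS; have /setP/(_ i) := gE; rewrite !inE iS andbT.
have hin i : i \in S -> (i \in h) = (i == b) || (i == c).
  by move=> iS; have /setP/(_ i) := hE; rewrite !inE iS andbT.
have away f : f \in [:: g; h] -> [disjoint f & S :\: P].
  rewrite !inE => fE; rewrite -setI_eq0; apply/eqP/setP=> i; rewrite PE !inE.
  case iS: (i \in S); rewrite ?andbF //.
  by case/orP: fE => /eqP ->; rewrite ?gin ?hin //; do 3!case: eqP.
have dg : [disjoint g & S :\: P] by apply: away; rewrite inE eqxx.
have dh : [disjoint h & S :\: P] by apply: away; rewrite !inE eqxx orbT.
have inbits y : #|y :&: P| = (a \in y) + (b \in y) + (c \in y).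
  by rewrite PE card_trace3.
have [ga gb gc] : [/\ a \in g, b \in g & (c \in g) = false].
  by rewrite !gin // !eqxx orbT ![c == _]eq_sym (negbTE ac) (negbTE bc).
have [ha hb hc] : [/\ (a \in h) = false, b \in h & c \in h].
  by rewrite !hin // !eqxx orbT (negbTE ab) (negbTE ac).
have bits := (inbits, in_symd, ga, gb, gc, ha, hb, hc).
have sg := span_add gG sx; have sh := span_add hG sx.
have sgh := span_add gG sh.
case: (leqP 2 #|x :&: P|) => le; first by exists x.
case: (leqP 2 #|symd g x :&: P|) => leg.
  by exists (symd g x); split=> //; apply: card_symd_away.
case: (leqP 2 #|symd h x :&: P|) => leh.
  by exists (symd h x); split=> //; apply: card_symd_away.
exists (symd g (symd h x)); split=> //; last by rewrite !card_symd_away.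
move: le leg leh; rewrite !bits.
by case: (a \in x); case: (b \in x); case: (c \in x).
Qed.

(** * Traces on disjoint triples *)

Definition flat g x := (#|x :&: g| == 0) || (#|x :&: g| == 3).

Lemma card_traces_le (I : finType) (D : {set I}) (F : I -> {set T}) A R :
  (forall b, b \in D -> F b \subset R) ->
  {in D &, forall b b', b != b' -> [disjoint F b & F b']} ->
  \sum_(b in D) #|A :&: F b| <= #|A :&: R|.
Proof.
move=> sR dF.
have cE b : b \in D -> #|A :&: F b| = \sum_(i in A :&: R) (i \in F b).
  move=> bD; rewrite -sum1_card big_mkcond [RHS]big_mkcond; apply: eq_bigr => i _.
  rewrite !inE; case: (i \in A) => //=; case iF: (i \in F b); last by case: ifP.
  by rewrite (subsetP (sR b bD) _ iF).
rewrite (eq_bigr _ cE) exchange_big -sum1_card; apply: leq_sum => i _ /=.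
case: (boolP [exists b in D, i \in F b]) => [/exists_inP [b bD iF]|no].
  rewrite (bigD1 b) //= iF big1 // => b' /andP [bD' ne].
  by rewrite (disjointFl (dF _ _ bD' bD ne) iF).
rewrite big1 // => b bD; apply/eqP; rewrite eqb0.
by apply: contra no => iF; apply/exists_inP; exists b.
Qed.

Lemma sum_card_traces x (F : {set {set T}}) :
  trivIset F -> \sum_(g in F) #|x :&: g| = #|x :&: cover F|.
Proof.
have cE A : #|x :&: A| = \sum_(i in A) (i \in x).
  rewrite -sum1_card big_mkcond [RHS]big_mkcond; apply: eq_bigr => i _.
  by rewrite inE; do 2![case: (i \in _)].
by move=> tF; rewrite cE big_trivIset //; apply: eq_bigr => g _.
Qed.

Lemma in_bigsymd_triv (F F0 : {set {set T}}) g i :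
  trivIset F -> F0 \subset F -> g \in F -> i \in g ->
  (i \in \big[symd/set0]_(h in F0) h) = (g \in F0).
Proof.
move=> /trivIsetP tF sF gF ig; rewrite in_bigsymd.
have away h : h \in F0 -> h != g -> (i \in h) = false.
  by move=> /(subsetP sF) hF ne; apply: disjointFl ig; apply: tF.
case: (boolP (g \in F0)) => gF0.
  by rewrite (bigD1 g) //= ig big1 // => h /andP [hF ne]; apply: away.
by rewrite big1 // => h hF; apply: away => //; apply: contraNneq gF0 => <-.
Qed.

(** Add every member of [F] on which [x] has at most one point. Each member then meets the sum in at
    least two points, an empty trace becomes full and a full one stays full, while the points
    outside [cover F] are untouched. *)
Lemma adjust_triples G (F : {set {set T}}) x :
  F \subset G -> trivIset F -> (forall g, g \in F -> #|g| = 3) -> span G x ->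
  exists2 x', span G x' &
    #|x :&: ~: cover F| + 2 * #|F| + \sum_(g in F) flat g x <= #|x'|.
Proof.
move=> FG tF F3 sx.
pose F0 := [set g in F | #|x :&: g| <= 1].
have sF0 : F0 \subset F by apply/subsetP=> g; rewrite inE => /andP[].
pose y := \big[symd/set0]_(g in F0) g.
exists (symd y x).
  apply: span_symd sx; apply: span_big => g gF.
  by apply: span_gen; apply: (subsetP FG); apply: (subsetP sF0).
have yE g i : g \in F -> i \in g -> (i \in y) = (g \in F0).
  exact: in_bigsymd_triv.
have dy : [disjoint y & ~: cover F].
  rewrite disjoints_subset setCK; apply/subsetP=> i; rewrite in_bigsymd => iy.
  apply: contraTT iy => iF; rewrite big1 // => g gF0; apply/negbTE.
  by apply: contra iF => ig; apply/bigcupP; exists g => //; apply: (subsetP sF0).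
have gain g : g \in F -> 2 + flat g x <= #|symd y x :&: g|.
  move=> gF; have g3 := F3 g gF; rewrite /flat.
  case: (boolP (g \in F0)) => gF0.
    rewrite card_symd_complement; last by apply/subsetP=> i ig; rewrite (yE g).
    have := cardsID x g; rewrite setIC; move: gF0; rewrite inE gF /=; lia.
  rewrite card_symd_away; last first.
    rewrite -setI_eq0; apply/eqP/setP=> i; rewrite !inE.
    by case ig: (i \in g); rewrite ?andbF // (yE g) // (negbTE gF0).
  by move: gF0; rewrite inE gF /= -ltnNge; lia.
rewrite -(cardsID (cover F) (symd y x)) [X in _ <= X]addnC setDE card_symd_away // -addnA leq_add2l.
apply: leq_trans (_ : \sum_(g in F) #|symd y x :&: g| <= _).
  by rewrite mulnC -sum_nat_const -big_split; apply: leq_sum => g /gain.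
by rewrite sum_card_traces.
Qed.

(** * Blocks of two overlapping pairs *)

Definition pair_word (b : {set T} * {set T}) v :=
  [|| v == b.1, v == b.2 | v == symd b.1 b.2].

Definition block R (b : {set T} * {set T}) := (b.1 :|: b.2) :&: R.

Definition is_block G R (b : {set T} * {set T}) :=
  [&& b.1 \in G, b.2 \in G, #|b.1 :&: R| == 2, #|b.2 :&: R| == 2 & #|block R b| == 3].

(** The count in the last clause forces the disjoint three-point blocks to cover [S]. [R] is kept
    apart from [S] because the induction shrinks [S] while the columns are measured on a fixed
    [R]. *)
Definition block_partition G R S (B : {set {set T} * {set T}}) :=
  [/\ forall b, b \in B -> is_block G R b /\ block R b \subset S,
      {in B &, forall b b', b != b' -> [disjoint block R b & block R b']} &
      3 * #|B| = #|S|].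

Lemma pair_word_span G R b v : is_block G R b -> pair_word b v -> span G v.
Proof.
case/and5P=> b1 b2 _ _ _ /or3P [] /eqP ->; try exact: span_gen.
by apply: span_add => //; apply: span_gen.
Qed.

Lemma pair_word_block R b v i : pair_word b v -> i \in v -> i \in R -> i \in block R b.
Proof.
case/or3P=> /eqP ->; rewrite !inE => iv ->; rewrite ?iv ?orbT //.
by move: iv; do 2![case: (i \in _)].
Qed.

(** On [R] the two pairs share one point; their sum drops it and keeps the other two points of the
    block. *)
Lemma pair_word_trace G R b v : is_block G R b -> pair_word b v -> #|v :&: block R b| = 2.
Proof.
case/and5P=> _ _ /eqP b1 /eqP b2 /eqP b3 pv.
have -> : v :&: block R b = v :&: R.
  apply/setP=> i; rewrite inE [RHS]inE; case iv: (i \in v) => //=.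
  by apply/idP/idP=> [/setIP[]|] // iR; apply: pair_word_block iv iR.
case/or3P: pv => /eqP -> //; rewrite /block setIUl in b3.
have := cardsUI (b.1 :&: R) (b.2 :&: R).
have := cardsID (b.1 :&: b.2 :&: R) ((b.1 :&: R) :|: (b.2 :&: R)).
rewrite (_ : _ :&: (b.1 :&: b.2 :&: R) = b.1 :&: R :&: (b.2 :&: R)); last first.
  by apply/setP=> i; rewrite !inE; do 3![case: (i \in _)].
rewrite (_ : _ :\: _ = symd b.1 b.2 :&: R); last first.
  by apply/setP=> i; rewrite !inE; do 3![case: (i \in _)].
lia.
Qed.

(** Within [R] a word of a block lies in that block alone, so on each block the sum keeps the two
    points of the word chosen there. *)
Lemma block_sum_large G R S (B : {set {set T} * {set T}}) (c : {set T} * {set T} -> {set T}) :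
  block_partition G R S B -> (forall b, pair_word b (c b)) ->
  2 * #|B| <= #|\big[symd/set0]_(b in B) c b :&: S|.
Proof.
case=> bB dB _ cP; set X := \big[_/_]_(_ in _) _.
apply: leq_trans (card_traces_le (F := block R) X (fun b bD => (bB b bD).2) dB).
rewrite mulnC -sum_nat_const; apply: leq_sum => b bD.
rewrite -(pair_word_trace (bB b bD).1 (cP b)); apply: subset_leq_card.
apply/subsetP=> i /setIP [ic ib]; rewrite inE ib andbT in_bigsymd (bigD1 b) //= ic.
rewrite big1 // => b' /andP [bD' ne]; apply/negbTE.
apply/negP=> ic'; have iR : i \in R by case/setIP: ib.
by rewrite (disjointFr (dB _ _ bD' bD ne) (pair_word_block (cP b') ic' iR)) in ib.
Qed.

Lemma block_partition_large G R S (B : {set {set T} * {set T}}) :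
  block_partition G R S B -> exists2 x, span G x & 2 * #|S| <= 3 * #|x :&: S|.
Proof.
move=> BP; have [bB _ BS] := BP.
have cP b : pair_word b b.1 by rewrite /pair_word eqxx.
pose X := \big[symd/set0]_(b in B) b.1.
have lX : 2 * #|B| <= #|X :&: S| by apply: block_sum_large BP cP.
exists X; last by rewrite -BS; lia.
by apply: span_big => b bD; apply: pair_word_span (bB b bD).1 (cP b).
Qed.

(** Strong induction on the size of [S], cutting off one piece at a time. A one-point trace or an
    isolated pair can be filled entirely, which beats two thirds; two overlapping pairs yield two
    points out of three and contribute a block. *)
Lemma pairs_dichotomy G R S :
  (forall g, g \in G -> #|g :&: R| <= 2) -> S \subset R -> S \subset cover G ->
  (exists2 x, span G x & 2 * #|S| < 3 * #|x :&: S|) \/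
  exists B, block_partition G R S B.
Proof.
have [m] := ubnP #|S|; elim: m G S => // m IH G S /ltnSE leS le2 SR cov.
have [S0|[i iS]] := set_0Vmem S.
  right; exists set0; split=> [b|b b'|]; rewrite ?inE //.
  by rewrite S0 !cards0.
have cardS P : P \subset S -> #|S| = #|P| + #|S :\: P|.
  by move=> PS; rewrite -(cardsID P S) (setIidPr PS).
have rec P G' : P \subset S -> 0 < #|P| -> G' \subset G -> S :\: P \subset cover G' ->
    (exists2 x, span G' x & 2 * #|S :\: P| < 3 * #|x :&: (S :\: P)|) \/
    exists B, block_partition G' R (S :\: P) B.
  move=> PS P0 /subsetP sG cov'; apply: IH => //; first by have := cardS P PS; lia.
    by move=> g /sG /le2.
  by apply: subset_trans SR; apply: subsetDl.
(* Both outcomes of the induction give the weak bound, which suffices when the removed piece is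
   filled entirely. *)
have rec_large P G' : P \subset S -> 0 < #|P| -> G' \subset G ->
    S :\: P \subset cover G' ->
    exists2 x, span G' x & 2 * #|S :\: P| <= 3 * #|x :&: (S :\: P)|.
  move=> PS P0 sG cov'; case: (rec P G' PS P0 sG cov') => [[x sx lex]|[B]].
    by exists x => //; apply: ltnW.
  exact: block_partition_large.
have covD P : S :\: P \subset cover G by apply: subset_trans cov; apply: subsetDl.
have dgS g : [disjoint g & S :\: (g :&: S)].
  by rewrite -setI_eq0; apply/eqP/setP=> j; rewrite !inE; do 2![case: (j \in _)].
(* A trace of two points on [S] already exhausts the trace on [R], so pairs found in [S] are pairs
   in [R]. *)
have trR g : g \in G -> #|g :&: S| = 2 -> g :&: R = g :&: S.
  by move=> gG g2; apply/esym/eqP; rewrite eqEcard setIS //= g2 le2.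
(* One-point trace: if the point is missing from [x], adding [g] supplies it and changes nothing
   else in [S]. *)
case: (boolP [exists g in G, #|g :&: S| == 1]) => [/exists_inP [g gG /eqP g1]|no1].
  left; have [|x sx lex] := rec_large (g :&: S) G (subsetIr _ _) _ (subxx _) (covD _).
    by rewrite g1.
  case: (leqP 1 #|x :&: (g :&: S)|) => le.
    by exists x => //; rewrite (card_traceD _ (subsetIr g S)) (cardS _ (subsetIr g S)); lia.
  exists (symd g x); first exact: span_add.
  rewrite (card_traceD _ (subsetIr g S)) (cardS _ (subsetIr g S)).
  rewrite (card_symd_away _ (dgS g)) card_symd_complement ?subsetIl //.
  by have := cardsID x (g :&: S); rewrite setIC; lia.
have two g : g \in G -> g :&: S != set0 -> #|g :&: S| = 2.
  move=> gG; rewrite -card_gt0 => gt0.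
  have : #|g :&: S| <= 2 by apply: leq_trans (le2 g gG); rewrite subset_leq_card ?setIS.
  have n1 : #|g :&: S| != 1 by apply: contra no1 => e; apply/exists_inP; exists g.
  lia.
have /bigcupP [g gG ig] := subsetP cov i iS.
have g2 : #|g :&: S| = 2 by apply: two => //; apply/set0Pn; exists i; rewrite inE ig.
case: (boolP [exists h in G, (g :&: h :&: S != set0) && (h :&: S != g :&: S)]).
  case/exists_inP=> h hG /andP [meet ne].
  have h2 : #|h :&: S| = 2.
    by apply: two => //; apply: contra meet => /eqP e; rewrite -setIA e setI0.
  (* Two distinct pairs that meet share exactly one point. *)
  have U3 : #|(g :|: h) :&: S| = 3.
    rewrite setIUl; have := cardsUI (g :&: S) (h :&: S); rewrite -setIIl => e.
    move: meet; rewrite -card_gt0 => I0.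
    have : #|g :&: h :&: S| != 2.
      apply: contra ne => /eqP I2; apply/eqP.
      have e1 : g :&: h :&: S = g :&: S.
        by apply/eqP; rewrite eqEcard I2 g2 leqnn andbT setSI ?subsetIl.
      by rewrite -e1; apply/esym/eqP; rewrite eqEcard I2 h2 leqnn andbT setSI ?subsetIr.
    have : #|g :&: h :&: S| <= 2 by rewrite -g2 subset_leq_card // setSI ?subsetIl.
    lia.
  have PS := subsetIr (g :|: h) S.
  have [|[x sx lex]|[B [bB dB cB]]] := rec _ G PS _ (subxx _) (covD _).
  - by rewrite U3.
  - left; have [x' [sx' ge2 away]] := gain_pairs gG hG g2 h2 U3 sx.
    by exists x' => //; rewrite (card_traceD _ PS) (cardS _ PS) away; lia.
  right; exists ((g, h) |: B).
  have blE : block R (g, h) = (g :|: h) :&: S by rewrite /block /= !setIUl !trR.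
  have disj b : b \in B -> [disjoint block R (g, h) & block R b].
    move=> bD; rewrite blE disjoint_sym disjoints_subset.
    by apply: subset_trans (bB b bD).2 _; rewrite setDE subsetIr.
  have nB : (g, h) \notin B.
    apply/negP=> /disj; rewrite -setI_eq0 setIid -cards_eq0 blE.
    by rewrite U3.
  split.
  - move=> b /setU1P [->|bD].
      by rewrite blE PS /is_block /= blE gG hG !trR // g2 h2 U3.
    have [? sb] := bB b bD; split=> //.
    by apply: subset_trans sb _; apply: subsetDl.
  - move=> b b' /setU1P [->|bD] /setU1P [->|bD'] nb; rewrite ?eqxx // in nb *.
    + exact: disj.
    + by rewrite disjoint_sym disj.
    + exact: dB.
  by rewrite cardsU1 nB (cardS _ PS) U3; lia.
(* Isolated pair: a column meeting it has the same trace on [S], so the columns avoiding the pair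
   still cover the rest. A word in their span misses the pair, and adding [g] wins both points. *)
move=> iso; left.
pose G' := [set h in G | [disjoint h & g :&: S]].
have sG' : G' \subset G by apply/subsetP=> h; rewrite inE => /andP[].
have [||x sx lex] := rec_large (g :&: S) G' (subsetIr _ _) _ sG'.
- by rewrite g2.
- apply/subsetP=> k /setDP [kS kgS].
  have /bigcupP [h hG kh] := subsetP cov k kS.
  apply/bigcupP; exists h => //; rewrite inE hG /=.
  apply: contraR iso => dis; apply/exists_inP; exists h => //; apply/andP; split.
    by move: dis; rewrite -setI_eq0 setIA [h :&: g]setIC.
  by apply: contraNneq kgS => <-; rewrite inE kh.
have dx : [disjoint x & g :&: S].
  by apply: span_avoid sx => h; rewrite inE => /andP[].
exists (symd g x).
  by apply: span_add gG _; apply: span_sub sx.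
rewrite (card_traceD _ (subsetIr g S)) (cardS _ (subsetIr g S)).
rewrite (card_symd_away _ (dgS g)) card_symd_complement ?subsetIl //.
by move: dx; rewrite disjoint_sym => /setDidPl ->; lia.
Qed.

(** * Maximal families of triples and the two-thirds bound *)

Lemma max_disjoint_triples G : (forall g, g \in G -> #|g| <= 3) ->
  exists F : {set {set T}}, [/\ F \subset G, trivIset F, forall g, g \in F -> #|g| = 3 &
    forall g, g \in G -> #|g :&: ~: cover F| <= 2].
Proof.
move=> le3.
pose ok (F : {set {set T}}) := [&& F \subset G, trivIset F & [forall g in F, #|g| == 3]].
have ok0 : ok set0.
  rewrite /ok sub0set /=; apply/andP; split.
    by apply/trivIsetP=> A B; rewrite inE.
  by apply/forall_inP=> g; rewrite inE.
have [F /and3P [FG tF /forall_inP F3] maxF] := @arg_maxnP _ set0 ok (fun F => #|F|) ok0.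
exists F; split=> // [g /F3 /eqP //|g gG].
(* Three points outside [cover F] make [g] a triple disjoint from [F], which could be adjoined. *)
rewrite leqNgt; apply/negP=> gt2.
have gR : g :&: ~: cover F = g.
  by apply/eqP; rewrite eqEcard subsetIl /=; apply: leq_trans (le3 g gG) gt2.
have g3 : #|g| == 3 by rewrite gR in gt2; have := le3 g gG; lia.
have dg h : h \in F -> [disjoint g & h].
  move=> hF; rewrite -gR -setI_eq0 -setIA; apply/eqP/setP=> i; rewrite !inE.
  apply/negbTE/negP=> /and3P [_ /negP nc ih]; apply: nc.
  by apply/bigcupP; exists h.
have gF : g \notin F.
  apply/negP=> /dg; rewrite -setI_eq0 setIid -cards_eq0.
  by rewrite (eqP g3).
have : ok (g |: F).
  apply/and3P; split.
  - by apply/subsetP=> h /setU1P [->|/(subsetP FG)].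
  - apply/trivIsetP=> A B /setU1P [->|AF] /setU1P [->|BF] ne; rewrite ?eqxx // in ne *.
    + exact: dg.
    + by rewrite disjoint_sym dg.
    + exact: (trivIsetP tF).
  - by apply/forall_inP=> h /setU1P [->|/F3].
by move/maxF; rewrite cardsU1 gF; lia.
Qed.

Lemma card_cover_triples (F : {set {set T}}) : trivIset F -> (forall g, g \in F -> #|g| = 3) ->
  #|T| = 3 * #|F| + #|~: cover F|.
Proof.
move=> /eqP tF F3; rewrite -(cardsC (cover F)) -tF; congr addn.
by rewrite (eq_bigr _ F3) sum_nat_const mulnC.
Qed.

(** Each member of [F] contributes at least two points out of three, so a strict gain outside
    [cover F] stays strict overall. *)
Lemma span_dichotomy G :
  (forall g, g \in G -> #|g| <= 3) -> cover G = setT ->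
  (exists2 x, span G x & 2 * #|T| < 3 * #|x|) \/
  exists (F : {set {set T}}) (B : {set {set T} * {set T}}),
    [/\ F \subset G, trivIset F, forall g, g \in F -> #|g| = 3 &
        block_partition G (~: cover F) (~: cover F) B].
Proof.
move=> le3 cov; have [F [FG tF F3 le2]] := max_disjoint_triples le3.
have [|[x sx lex]|[B BP]] := pairs_dichotomy le2 (subxx _).
- by rewrite cov subsetT.
- left; have [x' sx' lex'] := adjust_triples FG tF F3 sx; exists x' => //.
  by have := card_cover_triples tF F3; lia.
- by right; exists F, B.
Qed.

Lemma span_large G :
  (forall g, g \in G -> #|g| <= 3) -> cover G = setT ->
  exists2 x, span G x & 2 * #|T| <= 3 * #|x|.
Proof.
move=> le3 cov; case: (span_dichotomy le3 cov) => [[x sx lex]|].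
  by exists x => //; apply: ltnW.
case=> F [B [FG tF F3 BP]].
have [x sx lex] := block_partition_large BP.
have [x' sx' lex'] := adjust_triples FG tF F3 sx; exists x' => //.
by have := card_cover_triples tF F3; lia.
Qed.

(** * Flat words and the equality case *)

Lemma flatE a b c x : a != b -> a != c -> b != c ->
  flat [set a; b; c] x = ((a \in x) == (b \in x)) && ((b \in x) == (c \in x)).
Proof.
move=> ab ac bc; rewrite /flat card_trace3 //.
by case: (a \in x); case: (b \in x); case: (c \in x).
Qed.

(** Flat words are closed under sums, and [b.1] is the sum of the two words obtained by adding [b.2]
    and [symd b.1 b.2] to [y]; hence these are not both flat. *)
Lemma pair_word_not_flat g b y : #|g| = 3 -> ~~ flat g b.1 ->
  exists2 v, pair_word b v & ~~ flat g (symd v y).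
Proof.
case/cards3P=> a1 [a2 [a3 [n12 n13 n23 ->]]] nf.
have /or3P [] : [|| ~~ flat [set a1; a2; a3] (symd b.1 y),
    ~~ flat [set a1; a2; a3] (symd b.2 y) |
    ~~ flat [set a1; a2; a3] (symd (symd b.1 b.2) y)].
- move: nf; rewrite !flatE // !in_symd.
  by case: (a1 \in b.1); case: (a2 \in b.1); case: (a3 \in b.1); rewrite //=;
     do 6![case: (_ \in _)].
- by exists b.1 => //; rewrite /pair_word eqxx.
- by exists b.2 => //; rewrite /pair_word eqxx orbT.
- by exists (symd b.1 b.2) => //; rewrite /pair_word eqxx !orbT.
Qed.

(** The flat words on a triple form a subgroup of order two whose quotient has order four. Here
    [b.1], [b.2] and their sum represent its three nonzero classes, and [y] lies in one of them. *)
Lemma pair_word_flat g b y : #|g| = 3 -> ~~ flat g b.1 -> ~~ flat g b.2 ->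
  ~~ flat g (symd b.1 b.2) -> ~~ flat g y ->
  exists2 v, pair_word b v & flat g (symd v y).
Proof.
case/cards3P=> a1 [a2 [a3 [n12 n13 n23 ->]]] nf1 nf2 nf3 nfy.
have /or3P [] : [|| flat [set a1; a2; a3] (symd b.1 y),
    flat [set a1; a2; a3] (symd b.2 y) |
    flat [set a1; a2; a3] (symd (symd b.1 b.2) y)].
- move: nf1 nf2 nf3 nfy; rewrite !flatE // !in_symd.
  case: (a1 \in b.1); case: (a2 \in b.1); case: (a3 \in b.1) => //= _;
  case: (a1 \in b.2); case: (a2 \in b.2); case: (a3 \in b.2) => //= _ _;
  by case: (a1 \in y); case: (a2 \in y); case: (a3 \in y).
- by exists b.1 => //; rewrite /pair_word eqxx.
- by exists b.2 => //; rewrite /pair_word eqxx orbT.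
- by exists (symd b.1 b.2) => //; rewrite /pair_word eqxx !orbT.
Qed.

Lemma flat_bigsymd (I : finType) (D : {set I}) (F : I -> {set T}) g : #|g| = 3 ->
  (forall j, j \in D -> flat g (F j)) -> flat g (\big[symd/set0]_(j in D) F j).
Proof.
case/cards3P=> a1 [a2 [a3 [n12 n13 n23 ->]]] fl; rewrite flatE // !in_bigsymd.
have e j : j \in D -> (a1 \in F j) = (a2 \in F j) /\ (a2 \in F j) = (a3 \in F j).
  by move/fl; rewrite flatE // => /andP [/eqP -> /eqP].
by apply/andP; split; apply/eqP; apply: eq_bigr => j /e [].
Qed.

(** Double counting of the points that the words [b.1] have in members of [F]: each block accounts
    for one because columns have size three, and each [g] in [F] for one because exactly one block
    has its [b.1] meeting [g]. *)
Lemma block_triple_matching G (F : {set {set T}}) (B : {set {set T} * {set T}}) :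
  (forall g, g \in G -> #|g| = 3) -> trivIset F -> (forall g, g \in F -> #|g| = 3) ->
  block_partition G (~: cover F) (~: cover F) B ->
  (forall c, (forall b, pair_word b (c b)) -> forall g, g \in F ->
     ~~ flat g (\big[symd/set0]_(b in B) c b)) ->
  #|B| = #|F|.
Proof.
move=> G3 tF F3 [bB _ _] nonflat.
have b1 b : b \in B -> #|b.1 :&: cover F| = 1.
  move=> /bB [/and5P [bG _ /eqP b2 _ _] _].
  by have := cardsID (cover F) b.1; rewrite setDE b2 (G3 _ bG); lia.
have le1 g b : g \in F -> b \in B -> #|b.1 :&: g| <= 1.
  by move=> gF bD; rewrite -(b1 b bD) subset_leq_card // setIS // bigcup_sup.
rewrite -sum1_card -[RHS]sum1_card.
transitivity (\sum_(b in B) \sum_(g in F) #|b.1 :&: g|).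
  by apply: eq_bigr => b bD; rewrite sum_card_traces // b1.
rewrite exchange_big; apply: eq_bigr => g gF /=; have g3 := F3 g gF.
pose good (b : {set T} * {set T}) :=
  [&& ~~ flat g b.1, ~~ flat g b.2 & ~~ flat g (symd b.1 b.2)].
(* If every block had a word flat on [g], choosing these words would give a sum flat on [g]. *)
have [b0 b0B /and3P [nf1 nf2 nf3]] : exists2 b, b \in B & good b.
  apply/exists_inP; apply: contraT => no.
  pose c (b : {set T} * {set T}) :=
    if flat g b.1 then b.1 else if flat g b.2 then b.2 else symd b.1 b.2.
  have cP b : pair_word b (c b).
    by rewrite /c /pair_word; case: ifP => _; [|case: ifP => _]; rewrite eqxx ?orbT.
  have /negP [] := nonflat c cP g gF; apply: flat_bigsymd => // b bD.
  rewrite /c; case: ifP => // f1; case: ifP => // f2; apply: contraT => f3.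
  by case/negP: no; apply/exists_inP; exists b => //; rewrite /good f1 f2 f3.
rewrite (bigD1 b0) //= big1 ?addn0.
  by move: (le1 g b0 gF b0B) nf1; rewrite /flat; case: #|_ :&: g| => [|[]].
(* If a second block had its [b.1] meeting [g], one of its words would make the sum without [b0]
   non-flat, and a word of [b0] would then make the whole sum flat. *)
move=> b /andP [bD nb]; apply/eqP/contraT=> ne0.
have nfb : ~~ flat g b.1.
  by move: (le1 g b gF bD) ne0; rewrite /flat; case: #|_ :&: g| => [|[]].
pose y := \big[symd/set0]_(b' in B | (b' != b0) && (b' != b)) b'.1.
have [v pv nfv] := pair_word_not_flat y g3 nfb.
have [u pu fu] := pair_word_flat g3 nf1 nf2 nf3 nfv.
pose c b' := if b' == b0 then u else if b' == b then v else b'.1.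
have cP b' : pair_word b' (c b').
  rewrite /c; case: eqP => [->//|_]; case: eqP => [->//|_].
  by rewrite /pair_word eqxx.
have /negP [] := nonflat c cP g gF.
rewrite (bigD1 b0) //= (bigD1 b) ?bD //= {1 2}/c !eqxx (negbTE nb).
rewrite (eq_bigr fst) => [|b' /andP [/andP [_ n0] n1]]; last first.
  by rewrite /c (negbTE n0) (negbTE n1).
by under eq_bigl => b' do rewrite -andbA.
Qed.

(** If some choice of words is constant on a member of [F], that member can be filled, which gains
    one point over two thirds. Otherwise blocks and members of [F] are equally many, and each takes
    up three points. *)
Lemma span_equality_6dvd G :
  (forall g, g \in G -> #|g| = 3) -> cover G = setT ->
  (exists2 x, span G x & 2 * #|T| < 3 * #|x|) \/ 6 %| #|T|.
Proof.
move=> G3 cov.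
have le3 g : g \in G -> #|g| <= 3 by move/G3->.
case: (span_dichotomy le3 cov) => [|[F [B [FG tF F3 BP]]]]; first by left.
have cardT := card_cover_triples tF F3; have [bB _ cB] := BP.
(* Choices are taken as finite functions so that the existence of a flat one is decidable. *)
pose P (c : {ffun {set T} * {set T} -> {set T}}) :=
  [forall b, pair_word b (c b)] &&
  [exists g in F, flat g (\big[symd/set0]_(b in B) c b)].
case: (boolP [exists c, P c]) => [/existsP [c /andP [/forallP cP /exists_inP [g gF fg]]]|no].
  left; set X := \big[_/_]_(_ in _) _ in fg.
  have sX : span G X by apply: span_big => b bD; apply: pair_word_span (bB b bD).1 (cP b).
  have lX : 2 * #|B| <= #|X :&: ~: cover F| by apply: block_sum_large BP cP.
  have [x' sx' lex'] := adjust_triples FG tF F3 sX; exists x' => //.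
  have fl : 0 < \sum_(h in F) flat h X by rewrite (bigD1 g) //= fg.
  by move: cardT; rewrite -cB; lia.
right; have e : #|B| = #|F|.
  apply: block_triple_matching BP _ => // c cP g gF; apply: contra no => fg.
  apply/existsP; exists [ffun b => c b]; apply/andP; split.
    by apply/forallP=> b; rewrite ffunE.
  apply/exists_inP; exists g => //; congr (is_true (flat g _)): fg.
  by apply: eq_bigr => b _; rewrite ffunE.
by rewrite cardT -cB e -mulnDl dvdn_mulr.
Qed.

End Span.

(** * From spans of column sets to matrices over the field with two elements *)

Section Wirings.
Import GRing.Theory.
Local Open Scope ring_scope.

Lemma F2_addb (a b : 'F_2) : (a + b != 0) = (a != 0) (+) (b != 0).
Proof. by case: a => [[|[|//]] ?]; case: b => [[|[|//]] ?]. Qed.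

Lemma F2_mulb (a b : 'F_2) : (a * b != 0) = (a != 0) && (b != 0).
Proof. by rewrite mulf_eq0 negb_or. Qed.

Lemma F2_natb (b : bool) : ((b%:R : 'F_2) != 0) = b.
Proof. by case: b. Qed.

Definition supp n (u : 'cV['F_2]_n) : {set 'I_n} := [set i | u i 0 != 0].

(** Equal columns are merged, which leaves the span unchanged. *)
Definition columns n (W : 'M['F_2]_n) : {set {set 'I_n}} :=
  [set supp (col j W) | j in 'I_n].

Lemma suppD n (u v : 'cV['F_2]_n) : supp (u + v) = symd (supp u) (supp v).
Proof. by apply/setP=> i; rewrite !inE mxE F2_addb. Qed.

Lemma span_columns n (W : 'M['F_2]_n) x :
  span (columns W) x -> exists y, x = supp (W *m y).
Proof.
elim=> [|g z /imsetP [j _ ->] _ [y ->]].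
  by exists 0; apply/setP=> i; rewrite mulmx0 !inE mxE eqxx.
by exists (delta_mx j 0 + y); rewrite mulmxDr suppD colE.
Qed.

Lemma card_supp_col n (W : 'M['F_2]_n) j : #|supp (col j W)| = vdeg W j.
Proof. by apply: eq_card => i; rewrite !inE mxE. Qed.

Lemma cover_columns n (W : 'M['F_2]_n) : is_wiring W -> cover (columns W) = setT.
Proof.
move=> /forallP dW; apply/setP=> i; rewrite inE; apply/bigcupP.
exists (supp (col i W)); first by apply: imset_f.
by rewrite inE mxE (eqP (dW i)) oner_eq0.
Qed.

Lemma span_Mval n (W : 'M['F_2]_n) x : span (columns W) x -> (#|x| <= Mval W 0)%N.
Proof.
case/span_columns=> y ->.
have -> : #|supp (W *m y)| = hweight (W *m y + 0) by rewrite addr0.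
exact: (leq_bigmax (F := fun y => hweight (W *m y + 0))).
Qed.

Lemma inA_Mval n (W : 'M['F_2]_n) : inA 3 W -> (2 * n <= 3 * Mval W 0)%N.
Proof.
case/andP=> wW dW.
have [|x sx] := span_large _ (cover_columns wW).
  move=> _ /imsetP [j _ ->]; rewrite card_supp_col; apply: leq_trans dW.
  exact: leq_bigmax.
by rewrite card_ord => lex; have := span_Mval sx; lia.
Qed.

Lemma inAstar_Mval n (W : 'M['F_2]_n) :
  inAstar 3 W -> ~~ (6 %| n)%N -> (2 * n < 3 * Mval W 0)%N.
Proof.
case/andP=> wW /forallP dW n6.
have [_ /imsetP [j _ ->]||[x sx]|] := @span_equality_6dvd _ (columns W).
- by rewrite card_supp_col; apply/eqP.
- exact: cover_columns.
- by rewrite card_ord => lex; have := span_Mval sx; lia.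
- by rewrite card_ord (negbTE n6).
Qed.

Lemma inAstarW n m (W : 'M['F_2]_n) : inAstar m W -> inA m W.
Proof.
case/andP=> wW /forallP dW; rewrite /inA wW /=; apply/bigmax_leqP => j _.
by rewrite (eqP (dW j)).
Qed.

(** The default [n] takes part in the minimum, so the bound must hold for it as well. *)
Lemma bigminn_geq (I : finType) (P : pred I) (F : I -> nat) n k :
  (k <= n)%N -> (forall i, P i -> k <= F i)%N -> (k <= \big[minn/n]_(i | P i) F i)%N.
Proof. by move=> kn kF; apply: (big_ind (leq k)) => // a b ka kb; rewrite leq_min ka. Qed.

Lemma bigminn_leq (I : finType) (P : pred I) (F : I -> nat) n i :
  P i -> (\big[minn/n]_(i | P i) F i <= F i)%N.
Proof.
move=> Pi; rewrite -big_filter.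
have : i \in [seq j <- index_enum I | P j] by rewrite mem_filter Pi mem_index_enum.
elim: [seq _ <- _ | _] => // j s IH; rewrite inE big_cons => /predU1P [->|/IH le].
  exact: geq_minl.
exact: leq_trans (geq_minr _ _) le.
Qed.

(** * Constructions for the upper bounds *)

Definition attains (D : pred nat) n v := exists2 W : 'M['F_2]_n,
  is_wiring W /\ (forall j, D (vdeg W j)) & forall x, (hweight (W *m x) <= v)%N.

Lemma attains_Mval D n v : attains D n v -> exists2 W : 'M['F_2]_n,
  is_wiring W /\ (forall j, D (vdeg W j)) & (Mval W 0 <= v)%N.
Proof.
case=> W dW hW; exists W => //; apply/bigmax_leqP=> x _.
by rewrite addr0.
Qed.

Lemma card_split_ord m n (P : pred 'I_(m + n)) :
  #|[set i | P i]| = (#|[set i | P (lshift n i)]| + #|[set i | P (rshift m i)]|)%N.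
Proof. by rewrite -!sum1dep_card big_split_ord. Qed.

(** A block-diagonal wiring keeps all degrees and adds the two bounds. With [D] abstract this serves
    both degree at most two and degree exactly three. *)
Lemma attains_add D m n u v : attains D m u -> attains D n v -> attains D (m + n) (u + v).
Proof.
case=> U [/forallP wU dU] hU [V [/forallP wV dV] hV].
exists (block_mx U 0 0 V); [split|].
- apply/forallP=> i; case: (split_ordP i) => j ->.
    by rewrite block_mxEul wU.
  by rewrite block_mxEdr wV.
- move=> j; rewrite /vdeg card_split_ord; case: (split_ordP j) => k ->.
    rewrite [X in D (_ + X)%N](_ : _ = 0%N) ?addn0.
      by have := dU k; congr (is_true (D _)); apply: eq_card => i; rewrite !inE block_mxEul.
    by apply: eq_card0 => i; rewrite !inE block_mxEdl mxE eqxx.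
  rewrite [X in D (X + _)%N](_ : _ = 0%N) ?add0n.
    by have := dV k; congr (is_true (D _)); apply: eq_card => i; rewrite !inE block_mxEdr.
  by apply: eq_card0 => i; rewrite !inE block_mxEur mxE eqxx.
move=> x; rewrite -[x]vsubmxK mul_block_col !mul0mx addr0 add0r /hweight card_split_ord.
apply: leq_add.
  apply: leq_trans (hU (usubmx x)); apply: eq_leq; apply: eq_card => i.
  by rewrite !inE col_mxEu.
apply: leq_trans (hV (dsubmx x)); apply: eq_leq; apply: eq_card => i.
by rewrite !inE col_mxEd.
Qed.

(** Structural recursion lets checks over all words of a concrete length be decided by
    computation. *)
Fixpoint all_bitseqs n (P : pred bitseq) : bool :=
  if n is n'.+1 then all_bitseqs n' (fun s => P (false :: s) && P (true :: s)) else P [::].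

Lemma all_bitseqsP n (P : pred bitseq) s : all_bitseqs n P -> size s = n -> P s.
Proof.
elim: n P s => [|n IH] P [|b s] //= h [sz].
by have /andP [] := IH _ s h sz; case: b.
Qed.

(** Entry [i] of the product of the matrix [w] with the bit vector [s]. *)
Definition bit_word (w : nat -> nat -> bool) n (s : bitseq) i :=
  foldr (fun j => addb (w i j && nth false s j)) false (iota 0 n).

Definition check (w : nat -> nat -> bool) n (D : pred nat) v :=
  [&& all (fun i => w i i) (iota 0 n),
      all (fun j => D (count (fun i => w i j) (iota 0 n))) (iota 0 n) &
      all_bitseqs n (fun s => count (bit_word w n s) (iota 0 n) <= v)%N].

Lemma card_ord_count n (P : pred nat) : #|[set i : 'I_n | P i]| = count P (iota 0 n).
Proof.
by rewrite -sum1dep_card -(big_mkord P (fun=> 1%N)) -sum1_count /index_iota subn0.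
Qed.

Lemma check_attains w n D v : check w n D v -> attains D n v.
Proof.
have mem_n (i : 'I_n) : (i : nat) \in iota 0 n by rewrite mem_iota /=.
case/and3P=> /allP wd /allP dd cw; exists (\matrix_(i, j) (w i j)%:R); [split|].
- by apply/forallP=> i; rewrite mxE wd.
- move=> j; have := dd j (mem_n j); congr (is_true (D _)).
  rewrite -card_ord_count; apply: eq_card => i.
  by rewrite !inE mxE F2_natb.
move=> x; pose s := [seq x j 0 != 0 | j <- enum 'I_n].
have := all_bitseqsP cw (_ : size s = n); rewrite size_map size_enum_ord => /(_ erefl).
apply: leq_trans; apply: eq_leq; rewrite -card_ord_count; apply: eq_card => i.
rewrite !inE mxE /bit_word.
have -> : foldr (fun j => addb (w i j && nth false s j)) false (iota 0 n) =
    \big[addb/false]_(j < n) (w i j && (x j 0 != 0)).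
  transitivity (\big[addb/false]_(j < n) (w i j && nth false s j)).
    rewrite -(big_mkord xpredT (fun j => w i j && nth false s j)) /index_iota subn0.
    by elim: (iota 0 n) => [|k t IH]; rewrite ?big_nil ?big_cons //= IH.
  apply: eq_bigr => j _; congr andb.
  by rewrite (nth_map j) ?size_enum_ord // nth_ord_enum.
rewrite (big_morph (fun a : 'F_2 => a != 0) F2_addb (id1 := false)) ?eqxx //.
by apply: eq_bigr => j _; rewrite F2_mulb mxE F2_natb.
Qed.

Definition column_list (cols : seq (seq nat)) i j := i \in nth [::] cols j.

(** The value is 2n/3 rounded up. On three points the columns are the three pairs, whose sums have
    even size and so at most two points; at most two single points remain. *)
Lemma attains2 n : attains (leq^~ 2)%N n (n - n %/ 3)%N.
Proof.
have base : forall r, (r < 3)%N -> attains (leq^~ 2)%N r r.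
  by case=> [|[|[|]]] // _; apply: (@check_attains (column_list [:: [:: 0]; [:: 1]])%N).
have step : attains (leq^~ 2)%N 3 2.
  exact: (@check_attains (column_list [:: [:: 0; 1]; [:: 1; 2]; [:: 2; 0]])%N).
have [m] := ubnP n; elim: m n => // m IH n /ltnSE lt.
case: (ltnP n 3) => n3; first by rewrite divn_small // subn0; apply: base.
have := attains_add step (IH (n - 3)%N _).
by rewrite subnKC // (_ : 2 + _ = n - n %/ 3)%N; [apply; lia | lia].
Qed.

(* The columns used for n = 6 are triangles in K4, the points being its edges. *)
Lemma attains_star n : (3 <= n)%N ->
  attains (eq_op^~ 3%N) n (n - n %/ 3 + (n %% 6 == 3))%N.
Proof.
have [m] := ubnP n; elim: m n => // m IH n /ltnSE lt n3.
(* A sum of triangles has even degree at each of the four vertices, so it has at most four edges. *)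
have step : attains (eq_op^~ 3%N) 6 4.
  by apply: (@check_attains (column_list [:: [:: 0; 1; 2]; [:: 0; 1; 2]; [:: 0; 1; 2];
    [:: 0; 3; 4]; [:: 0; 3; 4]; [:: 1; 3; 5]])%N); vm_compute.
have base4 : attains (eq_op^~ 3%N) 4 3.
  by apply: (@check_attains (column_list [:: [:: 0; 1; 2]; [:: 0; 1; 2]; [:: 0; 1; 2];
    [:: 0; 1; 3]])%N); vm_compute.
(* Removing six points must leave at least three, hence the threshold nine; it lowers the value by
   four and keeps the residue modulo six. *)
case: (ltnP n 9) => n9; last first.
  have := attains_add step (IH (n - 6)%N _ _).
  by rewrite subnKC ?(leq_trans _ n9) // (_ : 4 + _ = n - n %/ 3 + (n %% 6 == 3))%N;
     [apply; lia | lia].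
(* The sizes three to eight remain; four and six are [base4] and [step], and eight is two copies of
   [base4]. *)
move: n3 n9; do 9?[case: n lt => [|n] lt //] => _ _.
- by apply: (@check_attains (column_list [:: [:: 0; 1; 2]; [:: 0; 1; 2]; [:: 0; 1; 2]])%N);
    vm_compute.
- by apply: (@check_attains (column_list [:: [:: 0; 1; 2]; [:: 0; 1; 2]; [:: 0; 1; 2];
    [:: 0; 3; 4]; [:: 0; 3; 4]])%N); vm_compute.
- by apply: (@check_attains (column_list [:: [:: 0; 1; 2]; [:: 0; 1; 2]; [:: 0; 1; 2];
    [:: 0; 1; 3]; [:: 0; 4; 5]; [:: 0; 4; 5]; [:: 0; 4; 6]])%N); vm_compute.
- exact: (attains_add base4 base4).
Qed.

(** * The values of [mu] and [mustar] *)

Lemma mu2E n : mu n 2 = (n - n %/ 3)%N.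
Proof.
apply/eqP; rewrite eqn_leq; apply/andP; split.
  have [W [wW dW] hW] := attains_Mval (attains2 n); apply: leq_trans hW.
  by apply: bigminn_leq; rewrite /inA wW; apply/bigmax_leqP=> j _; apply: dW.
apply: bigminn_geq => [|W /andP [wW dW]]; first exact: leq_subr.
(* The lower bound for degree three applies to degree two, where the construction already meets
   it. *)
have /inA_Mval : inA 3 W by rewrite /inA wW (leq_trans dW).
lia.
Qed.

Lemma mu3E n : mu n 3 = (n - n %/ 3)%N.
Proof.
apply/eqP; rewrite eqn_leq; apply/andP; split.
  have [W [wW dW] hW] := attains_Mval (attains2 n); apply: leq_trans hW.
  apply: bigminn_leq; rewrite /inA wW; apply/bigmax_leqP=> j _.
  by apply: leq_trans (dW j) _.
apply: bigminn_geq => [|W /inA_Mval]; first exact: leq_subr.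
lia.
Qed.

(** When n is 3 modulo 6, 2n/3 is an integer but 6 does not divide n, so equality is excluded and
    one more is needed. In all other cases the constructions meet the bound for [mu]. *)
Lemma mustar3E n : (3 <= n)%N -> mustar n 3 = (n - n %/ 3 + (n %% 6 == 3))%N.
Proof.
move=> n3; apply/eqP; rewrite eqn_leq; apply/andP; split.
  have [W [wW dW] hW] := attains_Mval (attains_star n3); apply: leq_trans hW.
  by apply: bigminn_leq; rewrite /inAstar wW; apply/forallP.
apply: bigminn_geq => [|W sW]; first by lia.
have := inA_Mval (inAstarW sW); case: eqP => [e _|_]; last by lia.
have : ~~ (6 %| n)%N by rewrite /dvdn e.
by move/(inAstar_Mval sW); lia.
Qed.

End Wirings.

Theorem theorem1p2 (n : nat) (hn : (0 < n)%N) :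
  mu n 3 = mu n 2 /\
  ((3 <= n)%N ->
     (forall k : nat, (0 < k)%N -> n = (6 * k - 3)%N -> mustar n 3 = (4 * k - 1)%N) /\
     ((~ exists k : nat, (0 < k)%N /\ n = (6 * k - 3)%N) -> mustar n 3 = mu n 3)).
Proof.
split; first by rewrite mu2E mu3E.
move=> n3; split=> [k k0 nE|no]; rewrite mustar3E // ?mu3E; first by lia.
case: eqP => [e|_]; last by rewrite addn0.
(* Residue 3 modulo 6 gives n = 6(k - 1) + 3 = 6k - 3 with k - 1 the quotient. *)
by case: no; exists (n %/ 6).+1; lia.
Qed.
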